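(* Let $f:S^1\to S^1$ be a $C^2$-smooth endomorphism with $\lambda=\min_{y\in S^1}f'(y)>1$, let $0<\varepsilon\le 1$, $0<\theta<1$, and let $v:S^1\to\mathbb R$ be a $C^{1+\varepsilon}$ function. Let $\alpha:S^1\to\mathbb R$ be the only bounded solution of $$v(x)=\alpha(f(x))-(f'(x))^{\theta}\alpha(x),\qquad x\in S^1 .$$ Then there are only two possibilities: 1. $\alpha$ is a $C^1$-smooth function; 2. $h_x(\alpha)=\theta$ for Lebesgue-almost every $x\in S^1$.
   Context: $S^1=\mathbb R/\mathbb Z$. The displayed equation has exactly one bounded solution, $\alpha(x)=-\sum_{i=0}^\infty \frac{v(f^i(x))}{((f^{i+1})'(x))^\theta}$. For a function $\omega$, the (optimal) Hölder exponent at the point $x$ is $$h_x(\omega)=\liminf_{y\to x,\ y\ne x}\frac{\log|\omega(x)-\omega(y)|}{\log|x-y|},$$ i.e. the limit as $\rho\to0$ of the infimum of this quotient over $y\in B_\rho(x)\setminus\{x\}$, where the quotient is taken to be $+\infty$ if $\omega(y)=\omega(x)$. *)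

(* Defs.v *)
From HB Require Import structures.
From mathcomp Require Import all_boot all_order all_algebra.
From mathcomp Require Import generic_quotient.
From mathcomp Require Import all_classical all_reals all_analysis.

Set Implicit Arguments.
Unset Strict Implicit.
Unset Printing Implicit Defensive.

Import Order.TTheory GRing.Theory Num.Theory.
Import numFieldNormedType.Exports.

Local Open Scope classical_set_scope.
Local Open Scope ring_scope.

Definition eq_mod1 {R : realType} : rel R := fun x y => x - y \is a Num.int.

Lemma eq_mod1_refl (R : realType) : reflexive (@eq_mod1 R).
Proof. by move=> x; rewrite /eq_mod1 subrr rpred0. Qed.

Lemma eq_mod1_sym (R : realType) : symmetric (@eq_mod1 R).
Proof. by move=> x y; rewrite /eq_mod1 -opprB rpredN. Qed.

Lemma eq_mod1_trans (R : realType) : transitive (@eq_mod1 R).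
Proof.
move=> y x z xy yz; rewrite /eq_mod1 -[x](subrK y) -addrA.
exact: rpredD.
Qed.

Canonical eq_mod1_equiv (R : realType) : equiv_rel R :=
  EquivRel (@eq_mod1 R) (@eq_mod1_refl R) (@eq_mod1_sym R) (@eq_mod1_trans R).

Definition circle (R : realType) : Type := {eq_quot (@eq_mod1_equiv R)}%qT.

Definition to_circle {R : realType} (x : R) : circle R :=
  (\pi_{eq_quot (@eq_mod1_equiv R)} x)%qT.

(* A function on the circle is read in the coordinate x of R as the 1-periodic
   function x |-> w (x mod 1); its smoothness is that of this function. *)
Definition periodic_lift {R : realType} {T : Type} (w : circle R -> T) : R -> T :=
  fun x => w (to_circle x).

(* Two continuous lifts of f differ by an integer constant, so the derivative of
   f at x mod 1 is F^`() x for any differentiable lift F of f. *)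
Definition is_lift {R : realType} (f : circle R -> circle R) (F : R -> R) : Prop :=
  forall x, f (to_circle x) = to_circle (F x).

Definition Cn {R : realType} (n : nat) (g : R -> R) : Prop :=
  (forall i, (i < n)%N -> forall x, derivable (g^`(i)%classic) x 1) /\
  continuous (g^`(n)%classic : R -> R).

Definition holder_continuous {R : realType} (e : R) (g : R -> R) : Prop :=
  exists C : R, forall x y, `|g x - g y| <= C * `|x - y| `^ e.

Definition C1_holder {R : realType} (e : R) (g : R -> R) : Prop :=
  (forall x, derivable g x 1) /\ holder_continuous e (g^`()%classic).

(* Only y close to x matters below, so the value at |x - y| = 1, where the
   denominator vanishes, is irrelevant. *)
Definition holder_quotient {R : realType} (w : R -> R) (x y : R) : \bar R :=
  if w y == w x then +oo%E else (ln `|w x - w y| / ln `|x - y|)%:E.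

Definition holder_exponent {R : realType} (w : R -> R) (x : R) : \bar R :=
  lime_inf (holder_quotient w x) x.

(* Main.v *)
Require Import Defs.
From HB Require Import structures.
From mathcomp Require Import all_boot all_order all_algebra.
From mathcomp Require Import generic_quotient.
From mathcomp Require Import all_classical all_reals all_analysis.
From mathcomp Require Import ring lra.
Set Implicit Arguments.
Unset Strict Implicit.
Unset Printing Implicit Defensive.
Import Order.TTheory GRing.Theory Num.Theory.
Import numFieldNormedType.Exports.
Local Open Scope classical_set_scope.
Local Open Scope ring_scope.

(** The dichotomy holds in a pointwise form: the exponent is at least theta at
    every point, and if it exceeds theta at a single point then alpha is C1. The
    argument is a deterministic rescaling along one orbit.

    Read everything on the line. Let A and V be the 1-periodic functions given by
    alpha and v. The lift F is an expanding bijection of the line with inverse G,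
    and the equation says that A is a fixed point of the affine operator
    T g = (k * g + V) o G, where k = F'^theta. Differentiating T g multiplies g' by
    k / F' = F'^(theta - 1), which is at most lambda^(theta - 1) < 1. Thus T
    contracts derivatives, and this is where theta < 1 enters.

    Fix x and apply T repeatedly to the constant A x. Since T is affine,
      A z - T^n (A x) z = ((F^n)'(y))^theta * (A y - A x),   z = F^n y,
    so T^n (A x) compares with A at unit scale around F^n x exactly as A x
    compares with A at scale 1 / (F^n)'(x) around x (sub_transfer_iter, with
    distortion to make sense of the scale). The contraction of derivatives bounds
    the functions T^n (A x) and makes their derivatives equicontinuous, uniformly
    in n, on a tube of fixed radius around the orbit
    (transfer_iter_bounded_tube and dtransfer_iter_equicontinuous).

    Lower bound: for y near x take n such that F^n y and F^n x are about 1 apart.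
    The left-hand side is bounded and (F^n)'(y) is of the order of 1 / |y - x|, so
    |A y - A x| <= C |y - x|^theta (holder_at).

    Rigidity: if |A y - A x| <= |y - x|^t near x with t > theta, the right-hand
    side tends to 0 uniformly on a tube wider than one period
    (approximation_of_holder). So, up to integer translations, A is a uniform limit
    of functions whose derivatives are equicontinuous, hence it is C1
    (approximable_C1). *)

(** * Real analysis *)

(** The intermediate point is located by convexity: it stays in every ball that
    contains both endpoints, which is the form needed to remain in a tube. *)
Lemma mean_value (R : realType) (g dg : R -> R) (a b : R) :
  (forall x : R, is_derive x 1 g (dg x)) ->
  exists2 c : R,
    forall w r : R, `|a - w| <= r -> `|b - w| <= r -> `|c - w| <= r &
    g b - g a = dg c * (b - a).
Proof.
move=> dgP.
have cg : continuous g.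
  by move=> x; apply/differentiable_continuous/derivable1_diffP.
wlog ab : a b / a <= b => [H|].
  case: (leP a b) => [/H //|/ltW /H [c h1 h2]].
  by exists c => [w r|]; [move=> ? ?; exact: h1|lra].
have [|c cab e] := MVT_segment ab (fun x _ => dgP x).
  exact: continuous_subspaceT.
move: cab; rewrite in_itv/= => /andP[ac cb]; exists c => // w r.
by rewrite !ler_norml => /andP[? ?] /andP[? ?]; apply/andP; split; lra.
Qed.

Lemma periodic_int (R : realType) (T : Type) (p : R -> T) :
  (forall x, p (x + 1) = p x) -> forall (m : int) x, p (x + m%:~R) = p x.
Proof.
move=> p1 m x.
have pn (n : nat) y : p (y + n%:R) = p y.
  by elim: n y => [|n IH] y; rewrite ?addr0 // -natr1 addrA p1.
case: m => n; first exact: pn.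
by rewrite NegzE mulrNz /= -[in RHS](subrK n.+1%:R x) pn.
Qed.

Lemma periodic_floor (R : realType) (T : Type) (p : R -> T) :
  (forall x, p (x + 1) = p x) -> forall x : R, exists m : int,
  [/\ 0 <= x + m%:~R, x + m%:~R < 1 & forall y, p (y + m%:~R) = p y].
Proof.
move=> p1 x; exists (- Num.floor x); split.
- by rewrite rmorphN subr_ge0 ge_floor.
- by rewrite rmorphN ltrBlDl -[X in _ + X]/(1%:~R) -intrD lt_succ_floor.
- exact: periodic_int.
Qed.

(** Heine on the fundamental domain: the near-covering form of compactness turns
    the pointwise moduli of continuity into a single one. *)
Lemma periodic_unif_continuous (R : realType) (p : R -> R) :
  continuous p -> (forall x, p (x + 1) = p x) ->
  forall e : R, 0 < e -> exists2 d : R, 0 < d &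
    forall x y, `|x - y| <= d -> `|p x - p y| <= e.
Proof.
move=> cp p1 e e0.
pose P (d x : R) := forall y, `|x - y| < d -> `|p x - p y| <= e.
have : \forall d \near (0:R)^'+, `[0, 1] `<=` P d.
  have /compact_near_coveringP := @segment_compact R 0 1; apply => x _.
  have /cvgrPdist_lt /(_ (e / 2)) := cp x.
  rewrite divr_gt0 // => /(_ isT) /nbhs_ballP[r /= r0 xr].
  have r2 : 0 < r / 2 by rewrite divr_gt0.
  near=> y d; rewrite /P /= => z yz.
  rewrite (splitr e) -(subrK (p x) (p y)) -addrA.
  apply: (le_trans (ler_normD _ _)); apply: lerD.
    rewrite distrC ltW //; apply: xr; rewrite /ball/=.
    apply: lt_trans (_ : _ < r / 2) _; last by lra.
    by near: y; exact: (nbhsx_ballx x (r/2) r2).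
  apply/ltW/xr; rewrite /ball/= -(subrK y x) -addrA.
  apply: (le_lt_trans (ler_normD _ _)); rewrite (splitr r); apply: ltrD.
    by near: y; exact: (nbhsx_ballx x (r/2) r2).
  apply: lt_trans yz _; near: d; exact: nbhs_right_lt.
move=> H.
near (0:R)^'+ => d.
have Hd : `[0, 1] `<=` P d by near: d.
have d0 : 0 < d by [].
exists (d / 2); first by rewrite divr_gt0.
move=> x y xy; have [m [m0 m1 pm]] := periodic_floor p1 x.
rewrite -(pm x) -(pm y); apply: Hd; first by rewrite /= in_itv/= m0 ltW.
by rewrite opprD addrACA subrr addr0 (le_lt_trans xy) //; lra.
Unshelve. all: by end_near. Qed.

Lemma periodic_bounded (R : realType) (p : R -> R) :
  continuous p -> (forall x, p (x + 1) = p x) ->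
  exists2 M, 0 <= M & forall x, `|p x| <= M.
Proof.
move=> cp p1.
have /compact_bounded[N [_ Nb]] : compact (p @` `[0, 1]).
  apply: continuous_compact (@segment_compact _ _ _).
  exact: continuous_subspaceT.
have {}Nb x : `|p x| <= `|N| + 1.
  have [m [m0 m1 pm]] := periodic_floor p1 x; rewrite -pm.
  apply: Nb; first by rewrite ltr_pwDr // ler_norm.
  by exists (x + m%:~R) => //=; rewrite in_itv/= m0 ltW.
by exists (`|N| + 1).
Qed.

(** A criterion for C1 regularity that survives pointwise limits, as it speaks of
    the values of the function only: if any two small chords, of nearby origins,
    have nearly the same slope, then the slopes at a point are Cauchy, so the
    derivative exists, and it inherits the modulus of continuity. The slopes are
    multiplied out so that degenerate chords need no special case. It replaces
    the extraction of a subsequence converging in the C1 topology. *)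
Lemma unif_slopes_C1 (R : realType) (g : R -> R) :
  (forall e : R, 0 < e -> exists2 d : R, 0 < d & forall x s y t, `|y - x| <= d ->
     `|s| <= d -> `|t| <= d ->
     `|(g (x + s) - g x) * t - (g (y + t) - g y) * s| <= e * (`|s| * `|t|)) ->
  Cn 1 g.
Proof.
move=> H.
pose q x s := s^-1 * (g (x + s) - g x).
have {}H e : 0 < e -> exists2 d, 0 < d & forall x s y t, `|y - x| <= d ->
     `|s| <= d -> `|t| <= d -> s != 0 -> t != 0 -> `|q x s - q y t| <= e.
  move=> /H[d d0 Hd]; exists d => // x s y t xy sd td s0 t0.
  rewrite -(ler_pM2r (_ : 0 < `|s| * `|t|)); last first.
    by rewrite mulr_gt0 ?normr_gt0.
  apply: le_trans (Hd _ _ _ _ xy sd td); rewrite -!normrM /q.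
  by rewrite le_eqVlt; apply/orP; left; apply/eqP; congr `| _ |; field; rewrite s0 t0.
have qc x : cvg (q x s @[s --> 0^']).
  apply/cauchy_cvgP/cauchy_ballP => e e0.
  have [d d0 Hd] := H (e / 2) ltac:(lra).
  rewrite near_simpl.
  near=> s t; rewrite /ball /=.
  apply: (@le_lt_trans _ _ (e / 2)); last by lra.
  apply: Hd.
  - by rewrite subrr normr0 ltW.
  - by near: s; exact: dnbhs0_le.
  - by near: t; exact: dnbhs0_le.
  - by near: s; exact: nbhs_dnbhs_neq.
  - by near: t; exact: nbhs_dnbhs_neq.
have qE x : q x = fun s => s^-1 *: ((g \o shift x) (s *: (1 : R)) - g x).
  apply/funext => s; rewrite /q /= -[s%:A]/(s * 1) mulr1 [s + x]addrC.
  by [].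
have dg x : derivable g x 1 by rewrite /derivable -qE; exact: qc.
have dqc x : q x s @[s --> 0^'] --> g^`()%classic x.
  by rewrite derive1E /derive -qE; exact: qc.
split; first by case.
rewrite derive1n1 => x; apply/cvgrPdist_le => e e0.
have [d d0 Hd] := H e e0.
near=> y.
have dq : q x s - q y s @[s --> 0^'] --> g^`()%classic x - g^`()%classic y.
  exact: cvgB.
apply: (cvgr_to_le (cvg_norm dq)); near=> s.
apply: Hd.
- near: y; have /cvgrPdist_le := @cvg_id _ (nbhs x).
  by under eq_near do rewrite distrC; apply.
- by near: s; exact: dnbhs0_le.
- by near: s; exact: dnbhs0_le.
- by near: s; exact: nbhs_dnbhs_neq.
- by near: s; exact: nbhs_dnbhs_neq.
Unshelve. all: by end_near. Qed.

Lemma exprn_unbounded (R : realType) (t l : R) : 1 < l -> exists n, t < l ^+ n.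
Proof.
move=> l1; have l0 : 0 < l by lra.
have /cvg_expr/cvgrPdist_lt : `|l^-1| < 1.
  by rewrite gtr0_norm ?invr_gt0 // invf_lt1.
move=> /(_ (`|t| + 1)^-1); rewrite invr_gt0 ltr_pwDr // => /(_ isT)[n _ /(_ n)].
rewrite /= leqnn => /(_ isT).
rewrite sub0r normrN exprVn gtr0_norm ?invr_gt0 ?exprn_gt0 //.
rewrite ltf_pV2 ?posrE ?exprn_gt0 ?ltr_pwDr // => tn; exists n.
by apply: le_lt_trans tn; rewrite (le_trans (ler_norm t)) // lerDl.
Qed.

Lemma holder_continuous_continuous (R : realType) (e : R) (g : R -> R) :
  0 < e -> holder_continuous e g -> continuous g.
Proof.
move=> e0 [C H] x; apply/cvgrPdist_lt => d d0.
have C0 : 0 < `|C| + 1 by rewrite ltr_pwDr.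
pose r := (d / (`|C| + 1)) `^ e^-1.
have r0 : 0 < r by rewrite powR_gt0 // divr_gt0.
have /cvgrPdist_lt/(_ r r0) := @cvg_id _ (nbhs x).
apply: filterS => y xy; apply: le_lt_trans (H x y) _.
have : `|x - y| `^ e < d / (`|C| + 1).
  have <- : r `^ e = d / (`|C| + 1).
    rewrite /r -powRrM mulVf ?gt_eqF // powRr1 // divr_ge0 // ltW //.
  by apply: gt0_ltr_powR; rewrite ?nnegrE ?(ltW r0).
rewrite ltr_pdivlMr // mulrC; apply: le_lt_trans.
by rewrite ler_wpM2r ?powR_ge0 // (le_trans (ler_norm _)) // lerDl.
Qed.

(** The derivative of a locally constant increment over one period is zero. For
    the lift of a circle map that increment is the degree. *)
Lemma derive_periodic (R : realType) (g dg : R -> R) :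
  (forall x : R, is_derive x 1 g (dg x)) ->
  (forall x : R, \forall y \near x, g (y + 1) - g y = g (x + 1) - g x) ->
  forall x, dg (x + 1) = dg x.
Proof.
move=> dgP H x.
have h0 : is_derive x 1 (fun y : R => y + 1) (1 + 0) :=
  is_deriveD (is_derive_id x (1 : R)) (is_derive_cst (1 : R) x (1 : R)).
have h1 : is_derive x 1 (fun y => g (y + 1)) (dg (x + 1)).
  apply: (is_derive_eq (@is_derive1_comp R g _ x _ _ (dgP _) h0)).
  by rewrite addr0 mulr1.
have h2 : is_derive x 1 (fun y => g (y + 1) - g y) _ := is_deriveB h1 (dgP x).
have h3 := near_eq_is_derive (H x) h2.
have [_ e1] := h3; have [_ e2] := is_derive_cst (g (x + 1) - g x) x 1.
by apply/eqP; rewrite -subr_eq0 -e1 -[X in _ == X]e2.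
Qed.

(** * The pointwise Holder exponent *)

Lemma lime_inf_ge (R : realType) (g : R -> \bar R) (x t : R) :
  (\forall y \near x^', (t%:E <= g y)%E) -> (t%:E <= lime_inf g x)%E.
Proof.
move=> /nbhs_ballP[r /= r0 H]; rewrite lime_infE.
apply: ereal_sup_ge => /=.
exists (- ereal_sup [set (- g y)%E | y in ball x r `\ x])%E.
  by exists r => //; rewrite in_itv/= r0.
rewrite leeNr; apply: ge_ereal_sup => _ [y [yr yx] <-].
by rewrite leeN2; apply: H => //; apply/eqP.
Qed.

Lemma lime_inf_gt (R : realType) (g : R -> \bar R) (x t : R) :
  (t%:E < lime_inf g x)%E -> exists2 s : R, t < s &
  \forall y \near x^', (s%:E <= g y)%E.
Proof.
rewrite lime_infE => /ereal_sup_gt[_ [r /= + <-]]; rewrite in_itv/= andbT => r0.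
set l := (- _)%E => tl.
have [s ts sl] : exists2 s, t < s & (s%:E <= l)%E.
  case: l tl => [l||] //.
  - by rewrite lte_fin => tl; exists l.
  - by move=> _; exists (t + 1); [rewrite ltrDl|rewrite leey].
exists s => //; apply/nbhs_ballP; exists r => //= y yr yx.
apply: le_trans sl _; rewrite /l leeNl; apply: ereal_sup_ubound.
by exists y => //; split => //; exact/eqP.
Qed.

(** The constant C disappears in the limit: it contributes ln C / ln |x - y|,
    which tends to 0. *)
Lemma holder_exponent_ge (R : realType) (w : R -> R) (x theta C : R) :
  0 < C -> (forall y, `|y - x| <= 1 -> `|w y - w x| <= C * `|y - x| `^ theta) ->
  (theta%:E <= holder_exponent w x)%E.
Proof.
move=> C0 H; apply/lee_subgt0Pr => e e0; rewrite -EFinB.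
apply: lime_inf_ge.
(* Below this distance the constant costs at most e in the quotient. *)
have E0 : 0 < expR (- ln C / e) by exact: expR_gt0.
near=> y; rewrite /holder_quotient.
case: eqVneq => [_|wyx]; first by rewrite leey.
have yx : y != x by near: y; exact: nbhs_dnbhs_neq.
have xy0 : 0 < `|x - y| by rewrite normr_gt0 subr_eq0 eq_sym.
have xy1 : `|x - y| < 1.
  by near: y; apply: cvg_within; apply: nbhsx_ballx.
have xyE : `|x - y| < expR (- ln C / e).
  by near: y; apply: cvg_within; apply: nbhsx_ballx.
have l0 : ln `|x - y| < 0 by rewrite ln_lt0 // xy0.
have lE : ln `|x - y| <= - ln C / e.
  by rewrite -(expRK (- ln C / e)) ler_ln ?posrE // ltW.
have w0 : 0 < `|w x - w y| by rewrite normr_gt0 subr_eq0 eq_sym.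
have : ln `|w x - w y| <= ln C + theta * ln `|x - y|.
  rewrite -ln_powR -lnM ?posrE ?powR_gt0 // ler_ln ?posrE ?mulr_gt0 ?powR_gt0 //.
  by rewrite distrC (distrC x y) H // distrC ltW.
rewrite lee_fin ler_ndivlMr // => h; apply: le_trans h _.
by rewrite ler_pdivlMr // in lE; lra.
Unshelve. all: by end_near. Qed.

Lemma holder_exponent_gt (R : realType) (w : R -> R) (x theta : R) :
  (theta%:E < holder_exponent w x)%E ->
  exists2 t, theta < t & exists2 d, 0 < d &
    forall y, `|y - x| < d -> `|w y - w x| <= `|y - x| `^ t.
Proof.
move=> /lime_inf_gt[t thetat /nbhs_ballP[d /= d0 H]]; exists t => //.
exists (Num.min d 1); first by rewrite lt_min d0 ltr01.
move=> y; rewrite lt_min => /andP[yd y1].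
have [->|yx] := eqVneq y x; first by rewrite subrr normr0 powR_ge0.
have := H y _ yx; rewrite /ball/= distrC => /(_ yd).
rewrite /holder_quotient; case: eqVneq => [-> _|wyx].
  by rewrite subrr normr0 powR_ge0.
have xy0 : 0 < `|x - y| by rewrite normr_gt0 subr_eq0 eq_sym.
have l0 : ln `|x - y| < 0 by rewrite ln_lt0 // xy0 distrC.
have w0 : 0 < `|w x - w y| by rewrite normr_gt0 subr_eq0 eq_sym.
rewrite lee_fin ler_ndivlMr // => h.
by rewrite (distrC y) (distrC (w y)) -ler_ln ?posrE ?powR_gt0 // ln_powR.
Qed.

(** * Expanding maps of the line and their inverse *)

Lemma iter_can (T : Type) (f g : T -> T) (n : nat) :
  cancel f g -> cancel (iter n f) (iter n g).
Proof. by move=> fK; elim: n => // n IH y; rewrite iterSr iterS fK IH. Qed.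

Section Inverse.
Variables (R : realType) (F F' : R -> R) (lambda : R).
Hypothesis dF : forall x : R, is_derive x 1 F (F' x).
Hypothesis lambda_gt1 : 1 < lambda.
Hypothesis F'_ge : forall x, lambda <= F' x.

Lemma expanding_dist (x y : R) : lambda * `|x - y| <= `|F x - F y|.
Proof.
have [c _ ->] := mean_value y x dF.
by rewrite normrM ler_wpM2r // (le_trans (F'_ge c)) // ler_norm.
Qed.

(** On the line an expanding map is a bijection, so a single global inverse
    replaces the inverse branches of the circle map. *)
Lemma expanding_inverse : exists G : R -> R, cancel F G /\ cancel G F.
Proof.
have cF : continuous F.
  by move=> x; apply/differentiable_continuous/derivable1_diffP.
have Finj : injective F.
  move=> x y xy; have := expanding_dist x y; rewrite xy subrr normr0 => h.
  apply/eqP; rewrite -subr_eq0 -normr_le0.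
  by rewrite -(pmulr_rle0 _ (lt_trans ltr01 lambda_gt1)).
have l1 := lambda_gt1.
have Fsurj (z : R) : exists x, F x == z.
  pose r : R := `|z - F 0|.
  have r0 : 0 <= r by exact: normr_ge0.
  have up (x : R) : 0 <= x -> F 0 + x <= F x.
    move=> x0; have [c _] := mean_value 0 x dF.
    have := F'_ge c; rewrite subr0 => c1 e.
    have : x <= F' c * x by rewrite ler_peMl //; lra.
    by rewrite -e; lra.
  have dn (x : R) : 0 <= x -> F (- x) <= F 0 - x.
    move=> x0; have [c _] := mean_value (- x) 0 dF.
    have := F'_ge c; rewrite sub0r opprK => c1 e.
    have : x <= F' c * x by rewrite ler_peMl //; lra.
    by rewrite -e; lra.
  have [| | |x _ xz] := @IVT _ F (- r) r z.
  - by lra.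
  - exact: continuous_subspaceT.
  - have := up _ r0; have := dn _ r0.
    have : `|z - F 0| <= r by exact: lexx.
    rewrite ler_norml => /andP[h1 h2] h3 h4.
    rewrite ge_min le_max; apply/andP; split; apply/orP; [left|right]; lra.
  - by exists x; apply/eqP.
pose G z := xchoose (Fsurj z).
have GK : cancel G F by move=> z; apply/eqP; exact: (xchooseP (Fsurj z)).
by exists G; split => // x; apply: Finj; rewrite GK.
Qed.

End Inverse.

(** * Regularity of the iterated transfer operator *)

(** The equation is studied in the form A = T A, where
    T g = (k * g + V) \o G is an operator acting through the contraction G. The bound
    k <= kappa * F' with kappa < 1 is what makes T regularizing: the chain rule
    divides k by F', so T contracts derivatives even where it expands values. *)
Section Transfer.
Variables (R : realType) (F G F' k dk V dV A : R -> R) (lambda kappa M : R).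
Hypothesis dF : forall x : R, is_derive x 1 F (F' x).
Hypothesis lambda_gt1 : 1 < lambda.
Hypothesis F'_ge : forall x, lambda <= F' x.
Hypothesis FK : cancel F G.
Hypothesis GK : cancel G F.
Hypothesis dkP : forall x : R, is_derive x 1 k (dk x).
Hypothesis dVP : forall x : R, is_derive x 1 V (dV x).
Hypotheses (cF' : continuous F') (cdk : continuous dk) (cdV : continuous dV).
Hypotheses (pF' : forall x, F' (x + 1) = F' x) (pk : forall x, k (x + 1) = k x).
Hypotheses (pdk : forall x, dk (x + 1) = dk x).
Hypotheses (pdV : forall x, dV (x + 1) = dV x) (pV : forall x, V (x + 1) = V x).
Hypothesis kappa_lt1 : kappa < 1.
Hypothesis k_le : forall x, `|k x| <= kappa * F' x.
Hypothesis AE : forall z, A z = k (G z) * A (G z) + V (G z).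
Hypothesis A_le : forall z, `|A z| <= M.

Let F'_gt0 x : 0 < F' x.
Proof. exact: lt_le_trans (lt_trans ltr01 lambda_gt1) (F'_ge x). Qed.

Lemma inverse_contracting (z w : R) : lambda * `|G z - G w| <= `|z - w|.
Proof. by have := expanding_dist dF F'_ge (G z) (G w); rewrite !GK. Qed.

Lemma is_derive_inverse_map (z : R) : is_derive z 1 G (F' (G z))^-1.
Proof.
have cF : continuous F.
  by move=> y; apply/differentiable_continuous/derivable1_diffP.
have := @is_derive_inverse R F G (F' (G z)) (G z).
rewrite GK; apply.
- by near=> y; exact: FK.
- by near=> y; exact: cF.
- by rewrite gt_eqF.
Unshelve. all: by end_near.
Qed.

(** The n-th iterate under T of the constant function c. *)
Fixpoint transfer_iter (c : R) (n : nat) (z : R) : R :=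
  if n is m.+1 then k (G z) * transfer_iter c m (G z) + V (G z) else c.

(** The derivative of the n-th iterate, in the form given by the chain rule. *)
Fixpoint dtransfer_iter (c : R) (n : nat) (z : R) : R :=
  if n is m.+1 then
    (dk (G z) * transfer_iter c m (G z) + dV (G z) +
     k (G z) * dtransfer_iter c m (G z)) / F' (G z)
  else 0.

Fixpoint cocycle (n : nat) (z : R) : R :=
  if n is m.+1 then k (G z) * cocycle m (G z) else 1.

Lemma is_derive_transfer_iter c n (z : R) :
  is_derive z 1 (transfer_iter c n) (dtransfer_iter c n z).
Proof.
elim: n z => [|n IH] z; first exact: is_derive_cst.
have dG := is_derive_inverse_map z.
have /= h1 := is_derive1_comp (dkP (G z)) dG.
have /= h2 := is_derive1_comp (IH (G z)) dG.
have /= h3 := is_derive1_comp (dVP (G z)) dG.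
have h : is_derive z 1 (transfer_iter c n.+1) _ :=
  is_deriveD (is_deriveM h1 h2) h3.
apply: (is_derive_eq h); rewrite /= /GRing.scale/=; ring.
Qed.

(** T is affine with fixed point A, so the distance to A of its iterates is the
    initial distance transported by G and multiplied by the cocycle: the iterates
    from the constant A x are a magnified view of the increments of A near x. *)
Lemma sub_transfer_iter c n z :
  A z - transfer_iter c n z = cocycle n z * (A (iter n G z) - c).
Proof.
elim: n z => [|n IH] z; first by rewrite mul1r.
by rewrite AE iterSr /= -mulrA -IH; ring.
Qed.

Variable x : R.
Notation w n := (iter n F x).

(** Started from the value A x, the n-th iterate takes the value of A at the n-th
    point of the orbit of x, hence stays bounded there although the cocycle grows. *)
Lemma transfer_iter_orbit n : transfer_iter (A x) n (w n) = A (w n).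
Proof.
by apply/eqP; rewrite eq_sym -subr_eq0 sub_transfer_iter (iter_can _ FK) subrr mulr0.
Qed.

Lemma tube_inverse n z L : `|z - w n.+1| <= L -> lambda * `|G z - w n| <= L.
Proof.
move=> h; apply: le_trans h.
by have := inverse_contracting z (w n.+1); rewrite iterS FK.
Qed.

Lemma tube_inverseW n z L : `|z - w n.+1| <= L -> `|G z - w n| <= L.
Proof. by move=> /tube_inverse; apply: le_trans; rewrite ler_peMl // ltW. Qed.

Let a y := dk y / F' y.
Let b y := dV y / F' y.
Let r y := k y / F' y.

Let continuous_divF' (g : R -> R) :
  continuous g -> continuous (fun y => g y / F' y).
Proof.
move=> cg y; apply: (@continuousM _ _ g (fun y => (F' y)^-1)); first exact: cg.
by apply: continuousV; [rewrite gt_eqF|exact: cF'].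
Qed.

Let continuous_k : continuous k.
Proof. by move=> y; apply/differentiable_continuous/derivable1_diffP. Qed.

Let ca : continuous a. Proof. exact: continuous_divF'. Qed.
Let cb : continuous b. Proof. exact: continuous_divF'. Qed.
Let cr : continuous r. Proof. exact: continuous_divF'. Qed.
Let pa y : a (y + 1) = a y. Proof. by rewrite /a pdk pF'. Qed.
Let pb y : b (y + 1) = b y. Proof. by rewrite /b pdV pF'. Qed.
Let pr y : r (y + 1) = r y. Proof. by rewrite /r pk pF'. Qed.

Let k_div_le y : `|r y| <= kappa.
Proof. by rewrite normrM normfV (gtr0_norm (F'_gt0 y)) ler_pdivrMr. Qed.

Let kappa_ge0 : 0 <= kappa. Proof. exact: le_trans (k_div_le 0). Qed.

Let dtransfer_iterS c n z :
  dtransfer_iter c n.+1 z =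
  a (G z) * transfer_iter c n (G z) + b (G z) + r (G z) * dtransfer_iter c n (G z).
Proof. by rewrite /= !mulrDl /a /b /r; ring. Qed.

(** Values are controlled through derivatives, by integrating from the orbit, and
    derivatives through values by the recursion. This circular argument closes
    when the radius rho of the tube is so small that the loss Sa * rho is absorbed
    by the gap 1 - kappa. *)
Lemma transfer_iter_bounded_small_tube : exists2 rho, 0 < rho & exists2 B, 0 <= B &
  forall n z, `|z - w n| <= rho -> `|transfer_iter (A x) n z| <= B.
Proof.
have [Sa Sa0 aS] := periodic_bounded ca pa.
have [Sb Sb0 bS] := periodic_bounded cb pb.
have [k1 k0] := (kappa_lt1, kappa_ge0).
have M0 : 0 <= M := le_trans (normr_ge0 _) (A_le x).
(* rho makes Sa * rho + kappa at most (1 + kappa) / 2, and D is then the fixed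
   point of the resulting affine bound on the derivatives. *)
pose rho := (1 - kappa) / (2 * (Sa + 1)).
pose D := 2 * (Sa * M + Sb) / (1 - kappa).
have rho0 : 0 < rho by rewrite divr_gt0 //; lra.
have D0 : 0 <= D by rewrite divr_ge0 //; nra.
have Sarho : Sa * rho <= (1 - kappa) / 2.
  have -> : Sa * rho = (1 - kappa) / 2 * (Sa / (Sa + 1)).
    by rewrite /rho; field; lra.
  by rewrite ler_piMr //; [lra|rewrite ler_pdivrMr; lra].
have DE : Sa * M + Sb = D * ((1 - kappa) / 2) by rewrite /D; field; lra.
clearbody rho D.
have key n :
    (forall z, `|z - w n| <= rho -> `|dtransfer_iter (A x) n z| <= D) ->
    forall z, `|z - w n| <= rho -> `|transfer_iter (A x) n z| <= M + D * rho.
  move=> H z zw.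
  have [c cP e] := mean_value (w n) z (is_derive_transfer_iter (A x) n).
  rewrite -(subrK (transfer_iter (A x) n (w n)) (transfer_iter _ _ z)) addrC.
  apply: le_trans (ler_normD _ _) _; apply: lerD; first by rewrite transfer_iter_orbit.
  rewrite e normrM; apply: ler_pM => //; apply: H.
  by apply: cP => //; rewrite subrr normr0 ltW.
exists rho => //; exists (M + D * rho); first by rewrite addr_ge0 // mulr_ge0 // ltW.
move=> n; apply: (key n); elim: n => [|n IH] z zw; first by rewrite /= normr0.
have {}zw := tube_inverseW zw.
rewrite dtransfer_iterS; apply: le_trans (ler_normD _ _) _.
apply: le_trans (lerD (ler_normD _ _) (lexx _)) _.
have h1 : `|a (G z) * transfer_iter (A x) n (G z)| <= Sa * (M + D * rho).
  by rewrite normrM; apply: ler_pM => //; exact: key.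
have h2 : `|r (G z) * dtransfer_iter (A x) n (G z)| <= kappa * D.
  by rewrite normrM; apply: ler_pM => //; exact: IH.
apply: le_trans (lerD (lerD h1 (bS (G z))) h2) _.
have h4 : Sa * rho * D <= (1 - kappa) / 2 * D by rewrite ler_wpM2r.
lra.
Qed.

(** As G contracts by lambda, one application of T carries a bound on a tube to a
    tube lambda times as wide; finitely many reach any radius. *)
Lemma transfer_iter_bounded_tube L : exists2 B, 0 <= B & forall n z,
  `|z - w n| <= L -> `|transfer_iter (A x) n z| <= B.
Proof.
have [rho rho0 [B0 B00 HB0]] := transfer_iter_bounded_small_tube.
have l1 := lambda_gt1.
have [SV SV0 VS] : exists2 M, 0 <= M & forall x, `|V x| <= M.
  apply: periodic_bounded pV => y.
  exact/differentiable_continuous/derivable1_diffP.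
have [Sk Sk0 kS] := periodic_bounded continuous_k pk.
have M0 : 0 <= M := le_trans (normr_ge0 _) (A_le x).
have H m : exists2 B, 0 <= B & forall n z,
  `|z - w n| <= lambda ^+ m * rho -> `|transfer_iter (A x) n z| <= B.
  elim: m => [|m [B B0' HB]].
    by exists B0 => // n z; rewrite mul1r; exact: HB0.
  exists (M + Sk * B + SV); first by rewrite !addr_ge0 ?mulr_ge0.
  case=> [|n] z zw /=.
    have SB : 0 <= Sk * B by exact: mulr_ge0.
    by have := A_le x; lra.
  have {}zw : `|G z - w n| <= lambda ^+ m * rho.
    rewrite -(ler_pM2l (_ : 0 < lambda)) ?mulrA -?exprS ?tube_inverse //; lra.
  apply: le_trans (ler_normD _ _) _; rewrite normrM.
  have := ler_pM (normr_ge0 _) (normr_ge0 _) (kS (G z)) (HB _ _ zw).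
  by have := VS (G z); lra.
have [m Lm] : exists m, L <= lambda ^+ m * rho.
  have [m] := exprn_unbounded (`|L| / rho) l1.
  rewrite ltr_pdivrMr // => h; exists m.
  by apply: le_trans (ltW h); exact: ler_norm.
have [B HB0' HB] := H m; exists B => // n z zw; apply: HB.
exact: le_trans zw Lm.
Qed.

Lemma dtransfer_iter_bounded_tube L : exists2 D, 0 <= D & forall n z,
  `|z - w n| <= L -> `|dtransfer_iter (A x) n z| <= D.
Proof.
have [B B0 phiB] := transfer_iter_bounded_tube L.
have [Sa Sa0 aS] := periodic_bounded ca pa.
have [Sb Sb0 bS] := periodic_bounded cb pb.
have [k1 k0] := (kappa_lt1, kappa_ge0).
pose D := (Sa * B + Sb) / (1 - kappa).
have D0 : 0 <= D by rewrite divr_ge0 //; nra.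
have DE : Sa * B + Sb = D * (1 - kappa) by rewrite /D; field; lra.
exists D => //; elim=> [|n IH] z zw; first by rewrite /= normr0.
have {}zw := tube_inverseW zw.
rewrite dtransfer_iterS; apply: le_trans (ler_normD _ _) _.
apply: le_trans (lerD (ler_normD _ _) (lexx _)) _.
have h1 : `|a (G z) * transfer_iter (A x) n (G z)| <= Sa * B.
  by rewrite normrM; apply: ler_pM => //; exact: phiB.
have h2 : `|r (G z) * dtransfer_iter (A x) n (G z)| <= kappa * D.
  by rewrite normrM; apply: ler_pM => //; exact: IH.
apply: le_trans (lerD (lerD h1 (bS (G z))) h2) _.
lra.
Qed.

(** The same contraction propagates a modulus of continuity of the derivatives
    along the recursion, with no loss from one iterate to the next. *)
Lemma dtransfer_iter_equicontinuous L e : 0 < e -> exists2 d, 0 < d & forall n z z',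
  `|z - w n| <= L -> `|z' - w n| <= L -> `|z - z'| <= d ->
  `|dtransfer_iter (A x) n z - dtransfer_iter (A x) n z'| <= e.
Proof.
move=> e0.
have [B B0 phiB] := transfer_iter_bounded_tube L.
have [D D0 dphiD] := dtransfer_iter_bounded_tube L.
have [Sa Sa0 aS] := periodic_bounded ca pa.
have [k1 k0] := (kappa_lt1, kappa_ge0).
(* Of the five terms of the difference, one is the inductive kappa * e; each of
   the four others gets a quarter of the remaining (1 - kappa) * e. *)
pose h := (1 - kappa) * e / 4.
have h0 : 0 < h by rewrite /h; nra.
have gt0 t : 0 <= t -> 0 < h / (t + 1) by move=> ?; rewrite divr_gt0 //; lra.
have hle t s : 0 <= t -> s <= h / (t + 1) -> s * t <= h.
  move=> t0; rewrite ler_pdivlMr; last by lra.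
  case: (ltrP s 0) => [s0 _|s0]; last by nra.
  by apply: le_trans (ltW h0); nra.
have [da da0 Ha] := periodic_unif_continuous ca pa (gt0 B B0).
have [db db0 Hb] := periodic_unif_continuous cb pb h0.
have [dr dr0 Hr] := periodic_unif_continuous cr pr (gt0 D D0).
pose d := Num.min (Num.min da db) (Num.min dr (h / (Sa * D + 1))).
exists d; first by rewrite !lt_min da0 db0 dr0 gt0 // mulr_ge0.
elim=> [|n IH] z z' zw zw' zz'; first by rewrite /= subrr normr0 ltW.
have {}zw := tube_inverseW zw; have {}zw' := tube_inverseW zw'.
have {}zz' : `|G z - G z'| <= d.
  apply: le_trans zz'; apply: le_trans (inverse_contracting z z').
  by rewrite ler_peMl // ltW.
move: (zz'); rewrite !le_min => /andP[/andP[zda zdb] /andP[zdr zds]].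
rewrite !dtransfer_iterS.
move: (G z) (G z') zw zw' zz' zda zdb zdr zds
  => {z} {}y {z'} y' yw yw' yy' ya yb yr ys.
set f := transfer_iter _ _; set df := dtransfer_iter _ _.
have -> : a y * f y + b y + r y * df y - (a y' * f y' + b y' + r y' * df y') =
  (a y - a y') * f y + a y' * (f y - f y') + (b y - b y') +
  (r y - r y') * df y + r y' * (df y - df y') by ring.
have h1 : `|(a y - a y') * f y| <= h.
  rewrite normrM; apply: le_trans (_ : `|a y - a y'| * B <= _).
    by apply: ler_wpM2l => //; exact: phiB.
  by apply: hle => //; exact: Ha.
have h2 : `|a y' * (f y - f y')| <= h.
  have [c cP e1] := mean_value y' y (is_derive_transfer_iter (A x) n).
  rewrite e1 normrM (normrM (dtransfer_iter _ _ _)).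
  have dc : `|dtransfer_iter (A x) n c| <= D by apply: dphiD; exact: cP.
  apply: le_trans (_ : `|y - y'| * (Sa * D) <= _).
    by rewrite [leRHS]mulrC mulrA ler_wpM2r // ler_pM.
  by apply: hle => //; exact: mulr_ge0.
have h3 : `|b y - b y'| <= h by exact: Hb.
have h4 : `|(r y - r y') * df y| <= h.
  rewrite normrM; apply: le_trans (_ : `|r y - r y'| * D <= _).
    by apply: ler_wpM2l => //; exact: dphiD.
  by apply: hle => //; exact: Hr.
have h5 : `|r y' * (df y - df y')| <= kappa * e.
  by rewrite normrM; apply: ler_pM => //; exact: IH.
apply: (le_trans (ler_normD _ _)).
apply: (le_trans (lerD (ler_normD _ _) (lexx _))).
apply: (le_trans (lerD (lerD (ler_normD _ _) (lexx _)) (lexx _))).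
apply: (le_trans (lerD (lerD (lerD (ler_normD _ _) (lexx _)) (lexx _)) (lexx _))).
by rewrite /h in h1 h2 h3 h4; lra.
Qed.

(** If A is uniformly close to iterates along the orbit, then A is C1 everywhere:
    the tube is wider than a period, so an integer translation brings any four
    nearby points into it; there the chords of an iterate have nearly equal slopes
    by equicontinuity, and the chords of A inherit this in the limit. *)
Lemma approximable_C1 : (forall y, A (y + 1) = A y) ->
  (forall e, 0 < e -> exists n, forall z, `|z - w n| <= 3 ->
     `|A z - transfer_iter (A x) n z| <= e) -> Cn 1 A.
Proof.
move=> pA apx; apply: unif_slopes_C1 => e e0.
have [d0 d00 Hd] := dtransfer_iter_equicontinuous 3 e0.
pose d := Num.min (d0 / 3) 1.
have dd : 0 < d by rewrite lt_min ltr01 andbT divr_gt0.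
exists d => // u s v t.
rewrite !le_min => /andP[uv uv1] /andP[sd s1] /andP[td t1].
apply/ler_addgt0Pr => eta eta0.
(* The approximation error may depend on the chords: only n depends on eta, and
   the modulus d does not depend on n. *)
have [n Hn] := apx (eta / 4) ltac:(lra).
have [m [m0 m1 pm]] := periodic_floor pA (u - w n).
rewrite -(pm (u + s)) -(pm u) -(pm (v + t)) -(pm v) ![_ + _ + m%:~R]addrAC.
have {}uv : `|(v + m%:~R) - (u + m%:~R)| <= d0 / 3.
  by rewrite opprD addrACA subrr addr0.
have {}uv1 : `|(v + m%:~R) - (u + m%:~R)| <= 1.
  by rewrite opprD addrACA subrr addr0.
have u0 : `|u + m%:~R - w n| <= 1 by rewrite addrAC ger0_norm // ltW.
move: (u + m%:~R) (v + m%:~R) u0 uv uv1 => {pm m m0 m1} {}u {}v u1 uv uv1.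
have triangle (p q q' l l' : R) :
    `|p - q| <= l -> `|q - q'| <= l' -> `|p - q'| <= l + l'.
  move=> h h'; rewrite -(subrKA q).
  by apply: le_trans (ler_normD _ _) (lerD h h').
have near_self (p q : R) : `|(p + q) - p| = `|q| by rewrite addrAC subrr add0r.
have us3 : `|u + s - w n| <= 3.
  by apply: le_trans (triangle _ _ _ _ _ _ u1) _; [rewrite near_self; exact: s1|lra].
have v2 : `|v - w n| <= 2.
  by apply: le_trans (triangle _ _ _ _ _ uv1 u1) _; lra.
have vt3 : `|v + t - w n| <= 3.
  by apply: le_trans (triangle _ _ _ _ _ _ v2) _; [rewrite near_self; exact: t1|lra].
have u3 : `|u - w n| <= 3 by lra.
have v3 : `|v - w n| <= 3 by lra.
have [c cP ec] := mean_value u (u + s) (is_derive_transfer_iter (A x) n).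
have [c' cP' ec'] := mean_value v (v + t) (is_derive_transfer_iter (A x) n).
have cu : `|c - u| <= d0 / 3.
  by apply: cP; rewrite ?near_self // subrr normr0; lra.
have cv : `|c' - v| <= d0 / 3.
  by apply: cP'; rewrite ?near_self // subrr normr0; lra.
have cc : `|c - c'| <= d0.
  rewrite distrC in uv; rewrite distrC in cv.
  by apply: le_trans (triangle _ _ _ _ _ cu (triangle _ _ _ _ _ uv cv)) _; lra.
have dcc := Hd n c c' (cP _ _ u3 us3) (cP' _ _ v3 vt3) cc.
move: ec ec'; rewrite !(addrAC _ _ (- _)) !subrr !add0r.
have := Hn _ u3; have := Hn _ us3; have := Hn _ v3; have := Hn _ vt3.
move: (transfer_iter (A x) n (u + s)) (transfer_iter (A x) n u)
  (transfer_iter (A x) n (v + t)) (transfer_iter (A x) n v) => q3 q4 q1 q2.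
move: dcc; set g := dtransfer_iter _ _ c; set g' := dtransfer_iter _ _ c' => dcc.
move=> h1 h2 h3 h4 ec ec'.
have -> : (A (u + s) - A u) * t - (A (v + t) - A v) * s =
  (g - g') * (s * t) + (((A (u + s) - q3) - (A u - q4)) * t -
    ((A (v + t) - q1) - (A v - q2)) * s).
  have -> : (g - g') * (s * t) = (g * s) * t - (g' * t) * s by ring.
  by rewrite -ec -ec'; ring.
have small (p q p' : R) : `|p| <= eta / 4 -> `|q| <= eta / 4 -> `|p'| <= 1 ->
    `|(p - q) * p'| <= eta / 2.
  move=> hp hq hp'; rewrite normrM -[leRHS]mulr1 ler_pM //.
  by apply: le_trans (ler_normB _ _) _; lra.
apply: le_trans (ler_normD _ _) _; apply: lerD.
  by rewrite !normrM ler_wpM2r // mulr_ge0.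
apply: le_trans (ler_normB _ _) _; rewrite (splitr eta).
by apply: lerD; apply: small.
Qed.

End Transfer.

(** * Bounded distortion *)

Section Distortion.
Variables (R : realType) (F G F' F'' : R -> R) (lambda : R).
Hypothesis dF : forall x : R, is_derive x 1 F (F' x).
Hypothesis dF' : forall x : R, is_derive x 1 F' (F'' x).
Hypothesis lambda_gt1 : 1 < lambda.
Hypothesis F'_ge : forall x, lambda <= F' x.
Hypothesis GK : cancel G F.
Variable S : R.
Hypothesis S_ge0 : 0 <= S.
Hypothesis F''_le : forall x, `|F'' x| <= S.

Let F'_gt0 x : 0 < F' x.
Proof. exact: lt_le_trans (lt_trans ltr01 lambda_gt1) (F'_ge x). Qed.

Notation Q := (cocycle G F').

Lemma derivative_cocycle_gt0 n z : 0 < Q n z.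
Proof. by elim: n z => [|n IH] z //=; rewrite mulr_gt0. Qed.

Lemma derivative_ratio (x y : R) : F' x <= expR (S * `|x - y|) * F' y.
Proof.
have [c _ e] := mean_value y x dF'.
have h : F' x <= F' y + S * `|x - y|.
  rewrite addrC -lerBlDr e; apply: le_trans (ler_norm _) _.
  by rewrite normrM ler_wpM2r.
have h1 : 1 + S * `|x - y| <= expR (S * `|x - y|) by exact: expR_ge1Dx.
have h2 : S * `|x - y| <= S * `|x - y| * F' y.
  by rewrite ler_peMr ?mulr_ge0 // (le_trans (ltW lambda_gt1)).
apply: le_trans h _; apply: le_trans (_ : (1 + S * `|x - y|) * F' y <= _).
  by rewrite mulrDl mul1r lerD2l.
by rewrite ler_wpM2r // ltW.
Qed.

(** The mean value theorem for F, with the intermediate derivative moved to the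
    point G z at the price of one exponential factor. *)
Lemma one_step_distortion (z w : R) :
  F' (G z) * `|G z - G w| <= expR (S * `|G z - G w|) * `|z - w| /\
  `|z - w| <= expR (S * `|G z - G w|) * (F' (G z) * `|G z - G w|).
Proof.
have [c cP] := mean_value (G w) (G z) dF; rewrite !GK => ->.
rewrite normrM (gtr0_norm (F'_gt0 c)) !mulrA.
have cz : `|c - G z| <= `|G z - G w|.
  by apply: cP; rewrite ?subrr ?normr0 // distrC.
have ez : expR (S * `|c - G z|) <= expR (S * `|G z - G w|).
  by rewrite ler_expR ler_wpM2l.
split; apply: ler_wpM2r => //.
- apply: le_trans (derivative_ratio (G z) c) _.
  by rewrite distrC ler_wpM2r // ltW.
- apply: le_trans (derivative_ratio c (G z)) _.
  by rewrite ler_wpM2r // ltW.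
Qed.

(** The solution of (C + S) / lambda = C, which sums the geometric series of the
    one-step errors. *)
Let C := S / (lambda - 1).

(** The cocycle of F' at z is the derivative of the n-th iterate of F at the
    preimage of z; the ratio of distances is comparable to it, uniformly in n. *)
Lemma distortion n (z w : R) :
  Q n z * `|iter n G z - iter n G w| <= expR (C * `|z - w|) * `|z - w| /\
  `|z - w| <= expR (C * `|z - w|) * (Q n z * `|iter n G z - iter n G w|).
Proof.
have l1 := lambda_gt1; have S0 := S_ge0.
have C0 : 0 <= C by rewrite divr_ge0 //; lra.
elim: n z w => [|n IH] z w.
  rewrite /= mul1r; have e1 : 1 <= expR (C * `|z - w|).
    by rewrite -expR0 ler_expR mulr_ge0.
  by split; rewrite ler_peMl.
have [h1 h2] := one_step_distortion z w.
have [i1 i2] := IH (G z) (G w).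
have E : expR (C * `|G z - G w|) * expR (S * `|G z - G w|) <= expR (C * `|z - w|).
  rewrite -expRD ler_expR -mulrDl.
  have -> : C + S = C * lambda by rewrite /C; field; lra.
  by rewrite -mulrA ler_wpM2l // (inverse_contracting dF F'_ge GK).
rewrite !iterSr /=; have F0 := ltW (F'_gt0 (G z)); split.
- rewrite -mulrA; apply: le_trans (ler_wpM2l F0 i1) _.
  rewrite mulrCA; apply: le_trans (ler_wpM2l (expR_ge0 _) h1) _.
  by rewrite mulrA ler_wpM2r.
- apply: le_trans h2 _; apply: le_trans (ler_wpM2l (expR_ge0 _) (ler_wpM2l F0 i2)) _.
  have comm (p q u v : R) : p * (u * (q * v)) = q * p * (u * v) by ring.
  rewrite comm -(mulrA (F' _)); apply: ler_wpM2r E.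
  by rewrite !mulr_ge0 // ltW // derivative_cocycle_gt0.
Qed.

End Distortion.

(** * Scaling of the solution along an orbit *)

Section Scaling.
Variables (R : realType) (F G F' F'' V A : R -> R) (lambda theta M S : R).
Hypothesis dF : forall x : R, is_derive x 1 F (F' x).
Hypothesis dF' : forall x : R, is_derive x 1 F' (F'' x).
Hypothesis lambda_gt1 : 1 < lambda.
Hypothesis F'_ge : forall x, lambda <= F' x.
Hypothesis FK : cancel F G.
Hypothesis GK : cancel G F.
Hypothesis S_ge0 : 0 <= S.
Hypothesis F''_le : forall x, `|F'' x| <= S.
Hypothesis theta_gt0 : 0 < theta.
Let k y := F' y `^ theta.
Hypothesis AE : forall z, A z = k (G z) * A (G z) + V (G z).
Hypothesis A_le : forall z, `|A z| <= M.
Variable x : R.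
Notation w n := (iter n F x).

Let F'_gt0 y : 0 < F' y.
Proof. exact: lt_le_trans (lt_trans ltr01 lambda_gt1) (F'_ge y). Qed.

Let Q_gt0 n z : 0 < cocycle G F' n z.
Proof. exact: derivative_cocycle_gt0 lambda_gt1 F'_ge _ _. Qed.

Lemma cocycle_powR n z : cocycle G k n z = cocycle G F' n z `^ theta.
Proof.
elim: n z => [|n IH] z /=; first by rewrite powR1.
by rewrite IH -powRM // ltW.
Qed.

(** Expansion drives the orbits of two distinct points apart; the last time at
    which they are within distance 1 is the scale of the pair. *)
Lemma exit_time (y : R) : y != x -> `|y - x| <= 1 -> exists n,
  `|iter n F y - w n| <= 1 /\ 1 < `|iter n.+1 F y - w n.+1|.
Proof.
move=> yx yx1.
have grow n : lambda ^+ n * `|y - x| <= `|iter n F y - w n|.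
  elim: n => [|n IH]; first by rewrite mul1r.
  rewrite exprS -mulrA !iterS; apply: le_trans (expanding_dist dF F'_ge _ _).
  by rewrite ler_wpM2l // ltW // (lt_trans ltr01).
have yx0 : 0 < `|y - x| by rewrite normr_gt0 subr_eq0.
have ex : exists n, 1 < `|iter n F y - w n|.
  have [n hn] := exprn_unbounded `|y - x|^-1 lambda_gt1.
  exists n; apply: lt_le_trans (grow n).
  by rewrite -ltr_pdivrMr // mul1r.
case: (ex_minnP ex) => -[|n] h hmin; first by move: h; rewrite ltNge yx1.
exists n; split=> //; rewrite leNgt; apply/negP => /hmin.
by rewrite ltnn.
Qed.

Lemma iter_inverse_contracting n (z v : R) :
  lambda ^+ n * `|iter n G z - iter n G v| <= `|z - v|.
Proof.
elim: n => [|n IH]; first by rewrite mul1r.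
rewrite exprSr -mulrA; apply: le_trans IH; apply: ler_wpM2l.
  by rewrite exprn_ge0 // ltW // (lt_trans ltr01).
exact: (inverse_contracting dF F'_ge GK).
Qed.

(** At the exit time n of y the two points F^n y and F^n x are at distance of
    order 1, so by distortion |y - x| is of the order of the inverse of the cocycle
    of F'. The increment of A is the difference of A and an iterate, which is
    bounded, divided by the power theta of that same cocycle. *)
Lemma holder_at (B S1 : R) : 0 <= B -> (forall y, F' y <= S1) ->
  (forall n z, `|z - w n| <= 1 -> `|transfer_iter G k V (A x) n z| <= B) ->
  exists2 C, 0 < C &
    forall y, `|y - x| <= 1 -> `|A y - A x| <= C * `|y - x| `^ theta.
Proof.
move=> B0 F'S phiB.
have M0 : 0 <= M := le_trans (normr_ge0 _) (A_le x).
have S10 : 0 < S1 := lt_le_trans (F'_gt0 x) (F'S x).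
pose E := expR (S / (lambda - 1)).
have E0 : 0 < E by exact: expR_gt0.
exists ((M + B + 1) * (S1 * E) `^ theta).
  by rewrite mulr_gt0 ?powR_gt0 ?mulr_gt0 //; lra.
move=> y yx1; have [->|yx] := eqVneq y x.
  by rewrite subrr normr0 !mulr_ge0 ?powR_ge0 //; lra.
have [n [zw]] := exit_time yx yx1; set z := iter n F y in zw *.
rewrite !iterS -/z => zw1.
have h1 : 1 <= S1 * `|z - w n|.
  apply: le_trans (ltW zw1) _; have [c _ ->] := mean_value (w n) z dF.
  by rewrite normrM gtr0_norm // ler_wpM2r.
have [_] := distortion dF dF' lambda_gt1 F'_ge GK S_ge0 F''_le n z (w n).
rewrite !(iter_can _ FK) -/E => h2.
have h3 : `|z - w n| <= E * (cocycle G F' n z * `|y - x|).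
  apply: le_trans h2 _; apply: ler_wpM2r; first by rewrite mulr_ge0 // ltW.
  rewrite ler_expR ler_piMr // divr_ge0 // subr_ge0 ltW //.
have h4 : 1 <= (S1 * E) * `|y - x| * cocycle G F' n z.
  apply: le_trans h1 _; rewrite -!mulrA ler_wpM2l ?(ltW S10) //.
  by rewrite (mulrC _ (cocycle _ _ _ _)).
have h5 : 1 <= ((S1 * E) `^ theta * `|y - x| `^ theta) * cocycle G k n z.
  have p1 := mulr_ge0 (ltW S10) (ltW E0); have p2 := ltW (Q_gt0 n z).
  rewrite cocycle_powR -powRM // -powRM ?mulr_ge0 ?(ltW S10) ?(ltW E0) //.
  have e1 : 1 `^ theta = 1 :> R by rewrite powR1.
  rewrite -[leLHS]e1 ge0_ler_powR ?nnegrE ?(ltW theta_gt0) //.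
  by rewrite mulr_ge0 // mulr_ge0.
have h6 : cocycle G k n z * `|A y - A x| <= M + B.
  have := sub_transfer_iter AE (A x) n z; rewrite (iter_can _ FK) => e.
  rewrite -[X in X * _]gtr0_norm ?cocycle_powR ?powR_gt0 // -cocycle_powR.
  rewrite -normrM -e; apply: le_trans (ler_normB _ _) _.
  by rewrite lerD // phiB.
have K0 : 0 < cocycle G k n z by rewrite cocycle_powR powR_gt0.
rewrite -mulrA; set P := _ `^ _ * _ in h5 *.
rewrite -(ler_pM2l K0); apply: le_trans h6 _.
rewrite mulrCA (mulrC _ P); have := ler_wpM2l (_ : 0 <= M + B + 1) h5.
by rewrite mulr1 => /(_ ltac:(lra)); lra.
Qed.

(** The power theta of the cocycle exactly compensates |y - x|^theta; an exponent
    t > theta leaves the factor |y - x|^(t - theta), and points y that G^n brings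
    from a tube of fixed radius are exponentially close to x. *)
Lemma approximation_of_holder (t d : R) : theta < t -> 0 < d ->
  (forall y, `|y - x| < d -> `|A y - A x| <= `|y - x| `^ t) ->
  forall L e, 0 < e -> exists n, forall z, `|z - w n| <= L ->
    `|A z - transfer_iter G k V (A x) n z| <= e.
Proof.
move=> tt d0 H L e e0.
have [L0|L0] := ltP L 0.
  exists 0%N => z zL.
  by have := le_lt_trans (le_trans (normr_ge0 _) zL) L0; rewrite ltxx.
pose E := expR (S / (lambda - 1) * L) * L.
have E0 : 0 <= E by rewrite mulr_ge0 // expR_ge0.
(* At distance below e' the spare factor |y - x|^(t - theta) beats E^theta. *)
pose e' := (e / (E `^ theta + 1)) `^ (t - theta)^-1.
have e'0 : 0 < e'.
  by rewrite powR_gt0 // divr_gt0 // ltr_pwDr // powR_ge0.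
pose d' := Num.min d e'.
have d'0 : 0 < d' by rewrite lt_min d0.
have [n hn] := exprn_unbounded (L / d') lambda_gt1.
exists n => z zL; rewrite (sub_transfer_iter AE).
set y := iter n G z.
have l0 : 0 < lambda := lt_trans ltr01 lambda_gt1.
have yn : lambda ^+ n * `|y - x| <= L.
  apply: le_trans zL.
  by have := iter_inverse_contracting n z (w n); rewrite (iter_can _ FK).
have yd : `|y - x| < d'.
  rewrite ltr_pdivrMr // in hn.
  rewrite -(ltr_pM2l (exprn_gt0 n l0)).
  exact: le_lt_trans yn hn.
have [h1 _] := distortion dF dF' lambda_gt1 F'_ge GK S_ge0 F''_le n z (w n).
rewrite (iter_can _ FK) -/y in h1.
have h2 : cocycle G F' n z * `|y - x| <= E.
  apply: le_trans h1 _; apply: ler_pM; rewrite ?expR_ge0 //.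
  by rewrite ler_expR ler_wpM2l // divr_ge0 // subr_ge0 ltW.
rewrite cocycle_powR normrM gtr0_norm ?powR_gt0 //.
move: yd; rewrite lt_min => /andP[yd ye].
apply: le_trans (ler_wpM2l (powR_ge0 _ _) (H _ yd)) _.
have -> : `|y - x| `^ t = `|y - x| `^ theta * `|y - x| `^ (t - theta).
  rewrite -powRD ?subrKC //.
  by rewrite (gt_eqF (lt_trans theta_gt0 tt)).
rewrite mulrA -powRM //; last exact: ltW.
have h3 : (cocycle G F' n z * `|y - x|) `^ theta <= E `^ theta.
  by rewrite ge0_ler_powR ?nnegrE ?mulr_ge0 // ltW.
have h4 : `|y - x| `^ (t - theta) <= e / (E `^ theta + 1).
  have -> : e / (E `^ theta + 1) = e' `^ (t - theta).
    rewrite /e' -powRrM mulVf ?powRr1 //; last by rewrite subr_eq0 gt_eqF.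
    by rewrite divr_ge0 ?ltW // ltr_pwDr // powR_ge0.
  by rewrite ge0_ler_powR ?nnegrE ?subr_ge0 // ltW.
apply: le_trans (ler_pM (powR_ge0 _ _) (powR_ge0 _ _) h3 h4) _.
have p0 := powR_ge0 E theta.
rewrite mulrCA ler_piMr ?(ltW e0) // ler_pdivrMr; lra.
Qed.

End Scaling.

(** * From the circle to the line *)

Lemma to_circle_eq (R : realType) (x y : R) :
  (to_circle x = to_circle y) <-> (x - y \is a Num.int).
Proof.
split; first by move=> /eqmodP.
by move=> h; apply/eqmodP.
Qed.

Lemma periodic_liftD1 (R : realType) (T : Type) (w : circle R -> T) (x : R) :
  periodic_lift w (x + 1) = periodic_lift w x.
Proof.
by congr w; apply/to_circle_eq; rewrite addrAC subrr add0r rpred1.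
Qed.

(** The increment over one period is a continuous function with integer values. *)
Lemma lift_increment_locally_cst (R : realType) (f : circle R -> circle R)
    (F : R -> R) : is_lift f F -> continuous F ->
  forall x : R, \forall y \near x, F (y + 1) - F y = F (x + 1) - F x.
Proof.
move=> fF cF x; pose H (y : R) := F (y + 1) - F y.
have Hint y : H y \is a Num.int.
  apply/to_circle_eq; rewrite -!fF.
  by congr f; apply/to_circle_eq; rewrite addrAC subrr add0r rpred1.
have cH : {for x, continuous H}.
  apply: continuousB; last exact: cF.
  apply: continuous_comp; last exact: cF.
  by apply: continuousD => //; exact: cst_continuous.
have /cvgrPdist_lt/(_ 1 ltr01) := cH.
apply: filterS => y; rewrite -/(H y) -/(H x) => h.
have /intrP[m e] : H x - H y \is a Num.int by rewrite rpredB.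
move: h; rewrite e -intr_norm ltrz1 => h.
have m0 : m = 0 by apply/eqP; rewrite -normr_le0 -ltzD1 add0r.
by apply/esym/eqP; rewrite -subr_eq0 e m0.
Qed.

(** * The dichotomy *)

Theorem theorem1 (R : realType)
  (f : circle R -> circle R) (F : R -> R)
  (f_lift : is_lift f F) (f_C2 : Cn 2 F)
  (lambda : R)
  (lambda_attained : exists y : R, F^`()%classic y = lambda)
  (lambda_le : forall y : R, lambda <= F^`()%classic y)
  (lambda_gt1 : 1 < lambda)
  (eps theta : R)
  (eps_gt0 : 0 < eps) (eps_le1 : eps <= 1)
  (theta_gt0 : 0 < theta) (theta_lt1 : theta < 1)
  (v : circle R -> R) (v_C1eps : C1_holder eps (periodic_lift v))
  (alpha : circle R -> R) (alpha_bounded : bounded_fun alpha)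
  (alpha_eq : forall x : R,
    v (to_circle x) =
      alpha (f (to_circle x)) - (F^`()%classic x) `^ theta * alpha (to_circle x)) :
  Cn 1 (periodic_lift alpha) \/
  {ae lebesgue_measure, forall x : R,
    holder_exponent (periodic_lift alpha) x = theta%:E}.
Proof.
set A := periodic_lift alpha; set V := periodic_lift v.
pose F' : R -> R := F^`()%classic; pose F'' : R -> R := F'^`()%classic.
have dF (x : R) : is_derive x 1 F (F' x).
  by rewrite /F' derive1E; apply: derivableP; exact: (f_C2.1 0%N).
have dF' (x : R) : is_derive x 1 F' (F'' x).
  by rewrite /F'' derive1E; apply: derivableP; exact: (f_C2.1 1%N).
have cF'' : continuous F'' by exact: f_C2.2.
have cont (g dg : R -> R) : (forall x : R, is_derive x 1 g (dg x)) -> continuous g.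
  by move=> dg' x; apply/differentiable_continuous/derivable1_diffP.
have cF' := cont _ _ dF'.
have pF' : forall x, F' (x + 1) = F' x.
  apply: (derive_periodic dF).
  by apply: lift_increment_locally_cst f_lift _; exact: cont dF.
have pF'' : forall x, F'' (x + 1) = F'' x.
  by apply: (derive_periodic dF') => x; near=> y; rewrite !pF' !subrr.
have F'_gt0 x : 0 < F' x := lt_le_trans (lt_trans ltr01 lambda_gt1) (lambda_le x).
have [G [FK GK]] := expanding_inverse dF lambda_gt1 lambda_le.
have [M _ A_le] : exists2 M, 0 <= M & forall z, `|A z| <= M.
  case: alpha_bounded => N [_ HN]; exists (`|N| + 1) => // z.
  by apply: HN => //; rewrite ltr_pwDr // ler_norm.
have AE z : A z = F' (G z) `^ theta * A (G z) + V (G z).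
  have := alpha_eq (G z); rewrite -/(V _) f_lift GK => e.
  by rewrite [V _]e addrC subrK.
pose dV : R -> R := V^`()%classic.
have dVP (x : R) : is_derive x 1 V (dV x).
  by rewrite /dV derive1E; apply: derivableP; exact: v_C1eps.1.
have pV : forall x, V (x + 1) = V x by move=> x; exact: periodic_liftD1.
have pA : forall x, A (x + 1) = A x by move=> x; exact: periodic_liftD1.
have pdV : forall x, dV (x + 1) = dV x.
  by apply: (derive_periodic dVP) => x; near=> y; rewrite !pV !subrr.
have cdV : continuous dV := holder_continuous_continuous eps_gt0 v_C1eps.2.
pose k y := F' y `^ theta.
pose dk y := theta * F' y `^ (theta - 1) * F'' y.
have dkP (x : R) : is_derive x 1 k (dk x).
  exact: is_derive1_comp (is_derive1_powR theta (F'_gt0 x)) (dF' x).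
have cdk : continuous dk.
  have cP : continuous (fun y => F' y `^ (theta - 1)) :=
    cont _ _ (fun y => is_derive1_comp
      (is_derive1_powR (theta - 1) (F'_gt0 y)) (dF' y)).
  move=> x; apply: (@continuousM _ _ (fun y => theta * F' y `^ (theta - 1)) F'').
    apply: (@continuousM _ _ (fun=> theta) (fun y => F' y `^ (theta - 1))).
      exact: cst_continuous.
    exact: cP.
  exact: cF''.
have pk : forall x, k (x + 1) = k x by move=> x; rewrite /k pF'.
have pdk : forall x, dk (x + 1) = dk x by move=> x; rewrite /dk pF' pF''.
pose kappa := lambda `^ (theta - 1).
have theta1 : 0 < 1 - theta by rewrite subr_gt0.
have lambda_gt0 := lt_trans ltr01 lambda_gt1.
have kappa_lt1 : kappa < 1.
  rewrite /kappa -opprB powRN invf_lt1 ?powR_gt0 //.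
  have e1 : 1 `^ (1 - theta) = 1 :> R by rewrite powR1.
  by rewrite -[ltLHS]e1; apply: gt0_ltr_powR; rewrite ?nnegrE ?(ltW lambda_gt0).
have k_le x : `|k x| <= kappa * F' x.
  rewrite ger0_norm ?powR_ge0 // /k -mulr_powRB1 ?(ltW (F'_gt0 x)) // mulrC.
  rewrite ler_pM2r // /kappa -opprB !powRN lef_pV2 ?posrE ?powR_gt0 //.
  by rewrite ge0_ler_powR ?nnegrE ?(ltW theta1) ?(ltW lambda_gt0) ?(ltW (F'_gt0 x)).
have [S S0 F''_le] := periodic_bounded cF'' pF''.
have [S1 _ F'_le'] := periodic_bounded cF' pF'.
have F'_le y : F' y <= S1 by exact: le_trans (ler_norm _) (F'_le' y).
case: (pselect (Cn 1 A)) => [|notC1]; [by left|right].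
apply: aeW => x /=; apply/eqP; rewrite eq_le; apply/andP; split.
  rewrite leNgt; apply/negP => /holder_exponent_gt[t tt [d d0 H]].
  apply: notC1; apply: (approximable_C1 dF lambda_gt1 lambda_le FK GK dkP dVP cF'
    cdk cdV pF' pk pdk pdV pV kappa_lt1 k_le AE A_le) pA _.
  exact: (approximation_of_holder dF dF' lambda_gt1 lambda_le FK GK S0 F''_le
    theta_gt0 AE tt d0 H).
have [B B0 phiB] := transfer_iter_bounded_tube dF lambda_gt1 lambda_le FK GK dkP dVP cF'
    cdk cdV pF' pk pdk pdV pV kappa_lt1 k_le AE A_le x 1.
have [C C0 H] := holder_at dF dF' lambda_gt1 lambda_le FK GK S0 F''_le
    theta_gt0 AE A_le B0 F'_le phiB.
exact: holder_exponent_ge C0 H.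
Unshelve. all: by end_near. Qed.
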